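(* Let $G$ be a finite connected graph (multiple edges allowed) and let $\{x,y\}$ be a generating pair for $G$. Let $\ell \ge 1$ be an integer and let $\tilde{G}$ be the graph obtained from $G$ by adding a new path of $\ell$ edges between $x$ and $y$; that is, $V(\tilde G)=V(G)\cup\{x_1,\ldots,x_{\ell-1}\}$ with $\ell-1$ new vertices, and $E(\tilde G)$ consists of the edges of $G$ together with new edges $x_0x_1, x_1x_2,\ldots,x_{\ell-1}x_\ell$, where $x_0=x$ and $x_\ell=y$ (for $\ell=1$ this adds one new edge between $x$ and $y$). Then for every $0\le i\le \ell-1$, the pair $\{x_i,x_{i+1}\}$ is a generating pair for $\tilde{G}$. In particular, the critical group $K(\tilde{G})$ is cyclic.
   Context: A configuration on a finite connected graph $G$ is a function $\delta: V(G)\to\mathbb{Z}$; its degree is $\sum_v \delta(v)$. A move consists of choosing a vertex $v$ and either firing (sending one chip along each edge incident to $v$ to the other endpoint, so $v$ loses its degree and each neighbor gains the number of edges joining it to $v$) or borrowing (the reverse). Two configurations are equivalent if one can be obtained from the other by a finite sequence of moves. The critical group $K(G)$ is the abelian group of equivalence classes of degree-zero configurations under vertexwise addition. For vertices $x,y$, $\delta_{x,y}$ is the configuration with $\delta_{x,y}(x)=1$, $\delta_{x,y}(y)=-1$, and $0$ elsewhere. A pair $\{x,y\}\subset V(G)$ is a generating pair if the class of $\delta_{x,y}$ generates $K(G)$; equivalently, every degree-zero configuration is equivalent to one that is zero except possibly at $x$ and $y$. *)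

(* Defs.v *)
From HB Require Import structures.
From mathcomp Require Import all_boot all_order all_algebra.
From mathcomp Require Import boolp.

Set Implicit Arguments.
Unset Strict Implicit.
Unset Printing Implicit Defensive.

Import GRing.Theory.
Local Open Scope ring_scope.
Local Open Scope quotient_scope.

(* The edges of a multigraph are undirected: [src] and [tgt] list the two
   endpoints of an edge in an arbitrary order. *)
Record multigraph := Multigraph {
  vertex : finType;
  edge : finType;
  src : edge -> vertex;
  tgt : edge -> vertex }.

Section Graph.
Variable G : multigraph.
Implicit Types (e : edge G) (u v x y : vertex G).

Definition joins e u v : bool :=
  (src e == u) && (tgt e == v) || (src e == v) && (tgt e == u).

Definition loopless : Prop := forall e, src e != tgt e.

Definition adjacent : rel (vertex G) := fun u v => [exists e, joins e u v].

(* Vacuous on the graph without vertices. *)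
Definition connected_graph : Prop := forall u v, connect adjacent u v.

Definition edge_mult u v : nat := #|[set e | joins e u v]|.

(* A loop would be counted once here, so this is the degree only when G is
   loopless. *)
Definition vertex_degree v : nat := #|[set e | (src e == v) || (tgt e == v)]|.

Definition config := {ffun vertex G -> int}.
HB.instance Definition _ := GRing.Zmodule.on config.

Implicit Types d : config.

Definition degree d : int := \sum_v d v.

Definition fire v d : config :=
  [ffun u => if u == v then d u - (vertex_degree v)%:Z
             else d u + (edge_mult v u)%:Z].

Definition borrow v d : config :=
  [ffun u => if u == v then d u + (vertex_degree v)%:Z
             else d u - (edge_mult v u)%:Z].

Inductive move := Fire of vertex G | Borrow of vertex G.

Definition make_move d (m : move) : config :=
  match m with Fire v => fire v d | Borrow v => borrow v d end.

Definition equivalent d1 d2 : Prop :=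
  exists s : seq move, foldl make_move d1 s = d2.

Lemma make_moveD d1 d2 m : make_move (d1 + d2) m = make_move d1 m + d2.
Proof.
by case: m => v; apply/ffunP => u; rewrite !ffunE; case: eqP => _;
  rewrite addrAC.
Qed.

Lemma equivalent_refl d : equivalent d d.
Proof. by exists [::]. Qed.

Lemma equivalent_trans d1 d2 d3 :
  equivalent d1 d2 -> equivalent d2 d3 -> equivalent d1 d3.
Proof. by move=> [s <-] [t <-]; exists (s ++ t); rewrite foldl_cat. Qed.

Lemma fireK v : cancel (fire v) (borrow v).
Proof.
by move=> d; apply/ffunP=> u; rewrite !ffunE; case: eqP;
  rewrite ?subrK ?addrK.
Qed.

Lemma borrowK v : cancel (borrow v) (fire v).
Proof.
by move=> d; apply/ffunP=> u; rewrite !ffunE; case: eqP;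
  rewrite ?subrK ?addrK.
Qed.

Lemma equivalent_sym d1 d2 : equivalent d1 d2 -> equivalent d2 d1.
Proof.
case=> s <-; elim: s d1 => [|m s IHs] d1 /=; first exact: equivalent_refl.
apply: equivalent_trans (IHs _) _.
by case: m => v; [exists [:: Borrow v] | exists [:: Fire v]];
  rewrite /= (fireK, borrowK).
Qed.

Lemma equivalentDr d d1 d2 :
  equivalent d1 d2 -> equivalent (d1 + d) (d2 + d).
Proof.
case=> s <-; exists s.
by elim: s d1 => [//|m s IHs] d1 /=; rewrite make_moveD IHs.
Qed.

Lemma equivalentD d1 d2 d1' d2' :
  equivalent d1 d1' -> equivalent d2 d2' -> equivalent (d1 + d2) (d1' + d2').
Proof.
move=> h1 h2; apply: equivalent_trans (equivalentDr d2 h1) _.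
by rewrite ![d1' + _]addrC; apply: equivalentDr.
Qed.

Lemma equivalentN d1 d2 : equivalent d1 d2 -> equivalent (- d1) (- d2).
Proof.
move=> /equivalent_sym /(equivalentDr (- d1 - d2)).
by rewrite addrCA subrr addr0 addrA subrr add0r.
Qed.

Definition degree_zero : {pred config} := fun d => degree d == 0.

Lemma degree_zero_zmod_closed : zmod_closed degree_zero.
Proof.
rewrite /degree_zero /degree; split=> [|d1 d2]; rewrite !unfold_in.
  by rewrite big1 // => v _; rewrite ffunE.
move=> /eqP h1 /eqP h2.
under eq_bigr do rewrite !ffunE.
by rewrite sumrB h1 h2 subrr.
Qed.
HB.instance Definition _ :=
  GRing.isZmodClosed.Build config degree_zero degree_zero_zmod_closed.

Record config0 :=
  Config0 { config0_val :> config; _ : config0_val \in degree_zero }.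
HB.instance Definition _ := [isSub for config0_val].
HB.instance Definition _ := [Choice of config0 by <:].
HB.instance Definition _ := [SubChoice_isSubZmodule of config0 by <:].

Definition equivalent0 (d1 d2 : config0) : bool := `[< equivalent d1 d2 >].

Lemma equivalent0_equiv : equiv_class_of equivalent0.
Proof.
split=> [d|d1 d2|d2 d1 d3].
- exact/asboolP/equivalent_refl.
- by apply/asboolP/asboolP; apply: equivalent_sym.
- by move=> /asboolP h12 /asboolP h23; apply/asboolP/(equivalent_trans h12 h23).
Qed.
Canonical equivalent0_equiv_rel := EquivRelPack equivalent0_equiv.

Lemma equivalent0N (d1 d2 : config0) :
  equivalent0 d1 d2 -> equivalent0 (- d1) (- d2).
Proof. by move=> /asboolP/equivalentN h; apply/asboolP. Qed.

Lemma equivalent0D (d1 d2 d1' d2' : config0) :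
  equivalent0 d1 d1' -> equivalent0 d2 d2' ->
  equivalent0 (d1 + d2) (d1' + d2').
Proof.
by move=> /asboolP h1 /asboolP h2; apply/asboolP; apply: (equivalentD h1 h2).
Qed.

Definition critical_group := {eq_quot equivalent0}.
HB.instance Definition _ : EqQuotient config0 equivalent0 critical_group :=
  EqQuotient.on critical_group.
HB.instance Definition _ := Choice.on critical_group.

Local Notation K := critical_group.

Definition critical_zero : K := lift_cst K (0 : config0).
Definition critical_opp := lift_op1 K (-%R : config0 -> config0).
Definition critical_add := lift_op2 K (+%R : config0 -> config0 -> config0).

Canonical pi_critical_zero := PiConst critical_zero.

Lemma pi_critical_opp : {morph \pi_K : d / - d >-> critical_opp d}.
Proof.
move=> d; unlock critical_opp; apply/eqP; rewrite piE.
by apply: equivalent0N; rewrite -eqmodE reprK.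
Qed.
Canonical pi_critical_opp_morph := PiMorph1 pi_critical_opp.

Lemma pi_critical_add : {morph \pi_K : d1 d2 / d1 + d2 >-> critical_add d1 d2}.
Proof.
move=> d1 d2; unlock critical_add; apply/eqP; rewrite piE.
by apply: equivalent0D; rewrite -eqmodE reprK.
Qed.
Canonical pi_critical_add_morph := PiMorph2 pi_critical_add.

Lemma critical_addA : associative critical_add.
Proof. by move=> a b c; rewrite -[a]reprK -[b]reprK -[c]reprK !piE addrA. Qed.
Lemma critical_addC : commutative critical_add.
Proof. by move=> a b; rewrite -[a]reprK -[b]reprK !piE addrC. Qed.
Lemma critical_add0 : left_id critical_zero critical_add.
Proof. by move=> a; rewrite -[a]reprK !piE add0r. Qed.
Lemma critical_addN : left_inverse critical_zero critical_opp critical_add.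
Proof. by move=> a; rewrite -[a]reprK !piE addNr. Qed.

HB.instance Definition _ := GRing.isZmodule.Build critical_group
  critical_addA critical_addC critical_add0 critical_addN.
HB.instance Definition _ := @isZmodQuotient.Build config0 equivalent0 0 -%R +%R
  critical_group (lock _) pi_critical_opp pi_critical_add.

Definition delta x y : config :=
  [ffun v => (v == x)%:Z - (v == y)%:Z].

Lemma degree_delta x y : delta x y \in degree_zero.
Proof.
rewrite unfold_in /degree; under eq_bigr do rewrite ffunE.
rewrite sumrB; have h z : \sum_v (v == z :> vertex G)%:Z = 1.
  by rewrite (bigD1 z) //= eqxx big1 ?addr0 // => v /negPf ->.
by rewrite !h subrr.
Qed.

Definition delta_class x y : critical_group :=
  \pi_critical_group (Config0 (degree_delta x y)).

End Graph.

Definition generates (A : zmodType) (g : A) : Prop :=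
  forall a : A, exists n : int, a = g *~ n.

Definition cyclic_zmod (A : zmodType) : Prop := exists g : A, generates g.

(* A pair consists of two distinct vertices. *)
Definition generating_pair (G : multigraph) (x y : vertex G) : Prop :=
  x != y /\ generates (delta_class x y).

Arguments generating_pair : clear implicits.

Section AddPath.
Variables (G : multigraph) (x y : vertex G) (l : nat).

(* [path_vertex k] is x_k for 0 <= k <= l: the vertex x for k = 0, the new
   vertex number k - 1 for 0 < k < l, and y for k = l. *)
Definition path_vertex (k : nat) : vertex G + 'I_l.-1 :=
  if k == 0%N then inl x
  else if insub k.-1 is Some j then inr j else inl y.

Definition add_path : multigraph :=
  @Multigraph (vertex G + 'I_l.-1)%type (edge G + 'I_l)%type
    (fun e => match e with inl e => inl (src e) | inr k => path_vertex k end)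
    (fun e => match e with inl e => inl (tgt e) | inr k => path_vertex k.+1 end).

End AddPath.

(* Main.v *)
(** In the critical group of the enlarged graph, firing an interior vertex of
    the new path shows that consecutive differences [x_k - x_(k+1)] all have
    the same class [p].  Hence [x - y] has class [l p], and a relation of [G]
    (firing a vertex [v] in [G]) holds up to a multiple of [p], which is
    nonzero only for [v = x] or [v = y].  As [x - y] generates modulo the
    relations of [G], everything is a multiple of [p]. *)
From HB Require Import structures.
Require Import Defs.
From mathcomp Require Import all_boot all_order all_algebra.
From mathcomp Require Import boolp.

Set Implicit Arguments.
Unset Strict Implicit.
Unset Printing Implicit Defensive.

Import GRing.Theory.
Local Open Scope ring_scope.
Local Open Scope quotient_scope.

(** * Laplacians, moves and classes of configurations *)

Section Laplacian.
Variable G : multigraph.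
Implicit Types (d : config G) (u v w x y : vertex G).

Lemma config_mulrzE d (n : int) u : (d *~ n) u = d u * n.
Proof.
have natE m : (d *+ m) u = d u * m%:Z.
  elim: m => [|m IHm]; first by rewrite mulr0n mulr0 ffunE.
  by rewrite mulrS ffunE IHm intS mulrDr mulr1.
by case: n => m; rewrite ?NegzE -?mulNrz /intmul ?mulrN1z ?ffunE natE // mulrN.
Qed.

Lemma delta_add u v w : delta u v + delta v w = delta u w.
Proof. by apply/ffunP => z; rewrite !ffunE addrA subrK. Qed.

Lemma deltaxx u : delta u u = 0.
Proof. by apply/ffunP => z; rewrite !ffunE subrr. Qed.

Lemma delta_opp u v : - delta u v = delta v u.
Proof. by apply/ffunP => z; rewrite !ffunE opprB. Qed.

(** The sum on the right is [d] minus [degree d] chips at [x], and the degree vanishes. *)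
Lemma degree_zero_sum_delta d x :
  d \in @degree_zero G -> d = \sum_v delta v x *~ d v.
Proof.
rewrite unfold_in => /eqP d0; apply/ffunP => u; rewrite sum_ffunE.
under eq_bigr do rewrite config_mulrzE ffunE mulrBl.
rewrite sumrB -mulr_sumr -/(degree d) d0 mulr0 subr0.
rewrite (bigD1 u) //= eqxx mul1r big1 ?addr0 // => v.
by rewrite eq_sym => /negPf ->; rewrite mul0r.
Qed.

(* Each edge incident to [v] contributes [v] minus its other endpoint, in
   either orientation. *)
Definition laplacian v : config G :=
  \sum_e delta (src e) (tgt e) *~ ((src e == v)%:Z - (tgt e == v)%:Z).

(** Links the sum over edges to the counts used by [fire] and [borrow]. A loop at [v] would
    contribute 0 to the sum but 1 to [vertex_degree v]. *)
Lemma laplacianE v u : loopless G ->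
  laplacian v u =
    if u == v then (vertex_degree v)%:Z else - (edge_mult v u)%:Z.
Proof.
move=> hG; rewrite /laplacian sum_ffunE.
under eq_bigr do rewrite config_mulrzE ffunE.
have not_loop e : ~~ ((src e == v) && (tgt e == v)).
  by apply/andP => -[/eqP se /eqP te]; have := hG e; rewrite se te eqxx.
rewrite /vertex_degree /edge_mult -!sum1_card.
have [->|neq_uv] := eqVneq u v.
  rewrite [in RHS]big_mkcond /= -natz natr_sum; apply: eq_bigr => e _.
  rewrite inE !(eq_sym v); have := not_loop e.
  by case: (src e == v); case: (tgt e == v).
rewrite [in RHS]big_mkcond /= -natz natr_sum -sumrN; apply: eq_bigr => e _.
have neq_vu : (v == u) = false by rewrite eq_sym; apply: negPf.
rewrite inE /joins !(eq_sym u); have := not_loop e.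
have [->|_] := eqVneq (src e) v; have [->|_] := eqVneq (tgt e) v;
  by rewrite ?neq_vu //=; case: (src e == u); case: (tgt e == u).
Qed.

Lemma fireE v d : loopless G -> fire v d = d - laplacian v.
Proof.
move=> hG; apply/ffunP => u; rewrite !ffunE laplacianE //.
by case: eqP => _; rewrite ?opprK.
Qed.

Lemma borrowE v d : loopless G -> borrow v d = d + laplacian v.
Proof.
move=> hG; apply/ffunP => u; rewrite !ffunE laplacianE //.
by case: eqP.
Qed.

Lemma laplacian_equivalent0 v : loopless G -> equivalent (laplacian v) 0.
Proof. by move=> hG; exists [:: Fire v]; rewrite /= fireE // subrr. Qed.

Lemma equivalent_mulrz d1 d2 (n : int) :
  equivalent d1 d2 -> equivalent (d1 *~ n) (d2 *~ n).
Proof.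
move=> h; have natE m : equivalent (d1 *+ m) (d2 *+ m).
  elim: m => [|m IHm]; first exact: equivalent_refl.
  by rewrite !mulrS; apply: equivalentD.
by case: n => m; [apply: natE | apply: equivalentN; apply: natE].
Qed.

(** The moves from [d1] to [d2] are undone one at a time: firing subtracts a Laplacian, so going
    back adds it, and conversely for borrowing. *)
Lemma equivalent_ind (P : config G -> Prop) d1 d2 : loopless G ->
    (forall d v, P d -> P (d + laplacian v)) ->
    (forall d v, P d -> P (d - laplacian v)) ->
  equivalent d1 d2 -> P d2 -> P d1.
Proof.
move=> hG hadd hsub [s <-]; elim: s d1 => [//|m s IHs] d1 /= /IHs.
case: m => v /=.
  by rewrite fireE // => /(hadd _ v); rewrite subrK.
by rewrite borrowE // => /(hsub _ v); rewrite addrK.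
Qed.

(** Replaces classes in the quotient by configurations, so that the graph argument needs no
    representatives. *)
Lemma generates_deltaP x y :
  generates (delta_class x y) <->
  (forall d, d \in @degree_zero G ->
     exists n : int, equivalent d (delta x y *~ n)).
Proof.
pose D := Config0 (degree_delta x y).
have valD (n : int) : config0_val (D *~ n) = delta x y *~ n.
  exact: (raddfMz (val : config0 G -> config G)).
have piD (n : int) : delta_class x y *~ n = \pi_(critical_group G) (D *~ n).
  by rewrite (raddfMz \pi_(critical_group G)).
split=> [gen d d0|gen a].
  have [n] := gen (\pi_(critical_group G) (Config0 d0)); rewrite piD => /eqmodP/asboolP /=.
  by rewrite valD; exists n.
elim/quotW: a => -[d d0]; have [n dn] := gen d d0.
by exists n; rewrite piD; apply/eqmodP/asboolP; rewrite valD.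
Qed.

(** * The subgroup generated by one configuration, modulo equivalence *)

Definition spanned (p d : config G) : Prop :=
  exists n : int, equivalent d (p *~ n).

Lemma spannedD p d1 d2 : spanned p d1 -> spanned p d2 -> spanned p (d1 + d2).
Proof.
move=> [m hm] [n hn]; exists (m + n).
by rewrite mulrzDr; apply: equivalentD.
Qed.

Lemma spannedMz p d (n : int) : spanned p d -> spanned p (d *~ n).
Proof.
by move=> [m hm]; exists (m * n); rewrite mulrzA; apply: equivalent_mulrz.
Qed.

Lemma spannedN p d : spanned p d -> spanned p (- d).
Proof. by rewrite -mulrN1z; apply: spannedMz. Qed.

Lemma spanned0 p : spanned p 0.
Proof. by exists 0; apply: equivalent_refl. Qed.

Lemma spanned_sum p (I : finType) (F : I -> config G) :
  (forall i, spanned p (F i)) -> spanned p (\sum_i F i).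
Proof.
by move=> hF; apply: big_ind => //; [apply: spanned0 | apply: spannedD].
Qed.

Lemma spanned_laplacian p v : loopless G -> spanned p (laplacian v).
Proof. by exists 0; apply: laplacian_equivalent0. Qed.

End Laplacian.

(** * The graph with the added path *)

Section AddPathTheory.
Variables (G : multigraph) (x y : vertex G) (l : nat).
Hypotheses (hG : loopless G) (neq_xy : x != y) (l_gt0 : (0 < l)%N).

Local Notation H := (add_path x y l).
Local Notation pv := (path_vertex x y l : nat -> vertex H).
Local Notation step k := (delta (pv k) (pv k.+1)).

Lemma path_vertex_ord (j : 'I_l.-1) : pv j.+1 = inr j.
Proof. by rewrite /path_vertex /= valK. Qed.

Lemma path_vertex_last : pv l = inl y.
Proof.
(* The index [l.-1] is just out of range for ['I_l.-1], so [insub] fails and the default [inl y] is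
   taken. *)
by rewrite /path_vertex -(prednK l_gt0) /= insubN // -leqNgt.
Qed.

Lemma path_vertexP k : (k <= l)%N ->
  [\/ k = 0%N, k = l | exists j : 'I_l.-1, k = j.+1].
Proof.
case: k => [|k]; first by constructor 1.
rewrite leq_eqVlt => /orP[/eqP ->|lt_kl]; first by constructor 2.
have lt_k : (k < l.-1)%N by rewrite -ltnS prednK.
by constructor 3; exists (Ordinal lt_k).
Qed.

Lemma path_vertex_inj k m : (k <= l)%N -> (m <= l)%N -> pv k = pv m -> k = m.
Proof.
move=> /path_vertexP[->|->|[j ->]] /path_vertexP[->|->|[i ->]];
  rewrite ?path_vertex_last ?path_vertex_ord //.
- by case=> exy; have := neq_xy; rewrite exy eqxx.
- by case=> exy; have := neq_xy; rewrite exy eqxx.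
- by case=> ->.
Qed.

Lemma path_vertex_eq k m : (k <= l)%N -> (m <= l)%N -> (pv k == pv m) = (k == m).
Proof.
by move=> kl ml; apply/eqP/eqP => [/path_vertex_inj|->] //; apply.
Qed.

Lemma add_path_loopless : loopless H.
Proof.
case=> [e|k]; first exact: (hG e).
rewrite /= path_vertex_eq ?ltn_ord // 1?ltnW ?ltn_ord //.
by rewrite neq_ltn ltnSn.
Qed.

(** Extension by zero is additive but need not preserve equivalence: firing [x] or [y] in [H] also
    sends chips into the path. *)
Definition embed (d : config G) : config H :=
  [ffun z : vertex H => if z is inl v then d v else 0 : int].

Fact embed_is_zmod_morphism : zmod_morphism embed.
Proof.
by move=> d1 d2; apply/ffunP => -[v|j]; rewrite !ffunE // subr0.
Qed.
HB.instance Definition _ :=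
  GRing.isZmodMorphism.Build (config G) (config H) embed embed_is_zmod_morphism.

Lemma embed_delta (u v : vertex G) :
  embed (delta u v) = delta (inl u : vertex H) (inl v).
Proof. by apply/ffunP => -[w|j]; rewrite !ffunE. Qed.

(** Edges of [G] contribute the same to both Laplacians, so these differ only by the path edges,
    whose contribution is a combination of steps. *)
Lemma embed_laplacian v :
  embed (laplacian v) = laplacian (inl v : vertex H)
    - \sum_(k < l) step k *~ ((pv k == inl v)%:Z - (pv k.+1 == inl v)%:Z).
Proof.
rewrite /laplacian big_sumType /= addrK raddf_sum; apply: eq_bigr => e _.
by rewrite raddfMz /= embed_delta.
Qed.

(** Only two edges meet this interior vertex: path edge [m.+1] starts there and path edge [m] ends
    there, whence the opposite signs. *)
Lemma laplacian_path_vertex m :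
  (m.+1 < l)%N -> laplacian (pv m.+1) = step m.+1 - step m.
Proof.
move=> ml; have lt_m : (m < l.-1)%N by rewrite -ltnS prednK.
have pvE : pv m.+1 = inr (Ordinal lt_m) by rewrite -path_vertex_ord.
rewrite /laplacian big_sumType /= big1 ?add0r; last first.
  by move=> e _; rewrite pvE subrr mulr0z.
under eq_bigr => k _.
  rewrite !path_vertex_eq ?ltn_ord ?(ltnW (ltn_ord k)) ?(ltnW ml) //.
  rewrite mulrzBr eqSS; over.
rewrite sumrB (bigD1 (Ordinal ml)) //= eqxx big1; last first.
  by move=> k; rewrite -val_eqE /= => /negPf->.
rewrite (bigD1 (Ordinal (ltnW ml))) //= eqxx big1; last first.
  by move=> k; rewrite -val_eqE /= => /negPf->.
by rewrite !addr0.
Qed.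

Lemma step_equivalent0 k : (k < l)%N -> equivalent (step k) (step 0).
Proof.
elim: k => [_|k IHk ltkl]; first exact: equivalent_refl.
apply: equivalent_trans (IHk (ltnW ltkl)).
have := laplacian_equivalent0 (pv k.+1) add_path_loopless.
rewrite laplacian_path_vertex // => /(equivalentDr (step k)).
by rewrite subrK add0r.
Qed.

Lemma spanned_step i k : (i < l)%N -> (k < l)%N -> spanned (step i) (step k).
Proof.
move=> il kl; exists 1; rewrite mulr1z.
apply: equivalent_trans (step_equivalent0 kl) _.
exact/equivalent_sym/step_equivalent0.
Qed.

(** The difference telescopes into the first [k] steps. The case [k = l] covers the difference of
    [x] and [y]. *)
Lemma spanned_path_delta i k :
  (i < l)%N -> (k <= l)%N -> spanned (step i) (delta (pv 0) (pv k)).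
Proof.
move=> il; elim: k => [_|k IHk ltkl].
  by rewrite deltaxx; apply: spanned0.
rewrite -(delta_add (pv 0) (pv k)); apply: spannedD; first exact/IHk/ltnW.
exact: spanned_step.
Qed.

Lemma spanned_embed_laplacian i v :
  (i < l)%N -> spanned (step i) (embed (laplacian v)).
Proof.
move=> il; rewrite embed_laplacian; apply: spannedD.
  exact/spanned_laplacian/add_path_loopless.
by apply/spannedN/spanned_sum => k; apply/spannedMz/spanned_step.
Qed.

(** Moves in [G] bring [d] to a multiple of [delta x y], whose embedding is spanned by telescoping
    along the whole path. Undoing each move changes the embedding by an embedded Laplacian, which is
    spanned too. *)
Lemma spanned_embed i d : (i < l)%N ->
    generates (delta_class x y) -> d \in @degree_zero G ->
  spanned (step i) (embed d).
Proof.
move=> il /generates_deltaP gen /gen[n].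
move/(equivalent_ind (P := fun d => spanned (step i) (embed d))); apply=> //.
- move=> d' v hd'; rewrite raddfD; apply: spannedD hd' _.
  exact: spanned_embed_laplacian.
- move=> d' v hd'; rewrite raddfB; apply/(spannedD hd')/spannedN.
  exact: spanned_embed_laplacian.
rewrite raddfMz /= embed_delta; apply: spannedMz.
by rewrite -path_vertex_last; apply: spanned_path_delta.
Qed.

Lemma add_path_generating_pair i : (i < l)%N ->
  generates (delta_class x y) -> generating_pair H (pv i) (pv i.+1).
Proof.
move=> il gen; split.
  by rewrite path_vertex_eq ?(ltnW il) // neq_ltn ltnSn.
apply/generates_deltaP => d d0; rewrite (degree_zero_sum_delta (pv 0) d0).
(* For an old vertex the difference with [pv 0], which is [inl x], comes from [G]; for a new vertex
   it telescopes along the path. *)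
apply: spanned_sum => -[v|j]; apply: spannedMz.
  by rewrite -embed_delta; apply: spanned_embed => //; apply: degree_delta.
rewrite -path_vertex_ord -(delta_opp (pv 0)); apply/spannedN/spanned_path_delta => //.
exact: leq_trans (ltn_ord j) (leq_pred l).
Qed.

End AddPathTheory.

Theorem theorem2p4 (G : multigraph) (x y : vertex G) (l : nat)
    (hG : loopless G) (hconn : connected_graph G)
    (hxy : generating_pair G x y) (hl : (1 <= l)%N) :
  (forall i : nat, (i <= l - 1)%N ->
     generating_pair (add_path x y l)
       (path_vertex x y l i) (path_vertex x y l i.+1))
  /\ cyclic_zmod (critical_group (add_path x y l)).
Proof.
have [neq_xy gen] := hxy.
have pair i (il : (i < l)%N) := add_path_generating_pair hG neq_xy hl il gen.
split=> [i il|]; first by apply: pair; rewrite -(prednK hl) ltnS -subn1.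
by have [_ gen0] := pair 0%N hl; eexists; exact: gen0.
Qed.
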